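(* For all integers $m,r\ge1$, $$\frac{\bigl[4^{m+1}(2m)!\bigr]^r}{|E_{2m}|^r\,\pi^{(2m+1)r}}=1+\sum_{n=1}^{\infty}\frac1{3^n}\sum_{j=1}^{n}\binom{r+j-1}{j}\sum_{\substack{n_1+\cdots+n_j=n\\ n_i\ge1}}\ \prod_{\ell=1}^{j}\left[\sum_{k=1}^{n_\ell}\frac{(-1)^{k+1}2^k}{(2k+1)^{2m+1}}\binom{n_\ell-1}{k-1}\right].$$ For every $n\ge1$, the coefficient of $3^{-n}$ (that is, the sum over $j$ from $1$ to $n$) is a positive rational number.
   Context: The Euler numbers $E_n$ are defined by $\operatorname{sech}z=\frac{2}{e^z+e^{-z}}=\sum_{n=0}^\infty E_n\frac{z^n}{n!}$ for $|z|<\pi/2$ (so $E_0=1$, $E_2=-1$, $E_4=5$, $E_6=-61$, $E_8=1385$). The sum over $n_1+\cdots+n_j=n$, $n_i\ge1$, is over ordered $j$-tuples of positive integers with sum $n$. *)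

(* Defs.v *)
From HB Require Import structures.
From mathcomp Require Import all_boot all_order all_algebra.
From mathcomp Require Import all_classical all_reals all_analysis.

Set Implicit Arguments.
Unset Strict Implicit.
Unset Printing Implicit Defensive.

Import Order.TTheory GRing.Theory Num.Theory.
Import numFieldNormedType.Exports.

Local Open Scope classical_set_scope.
Local Open Scope ring_scope.

(* The expansion on the real interval ]-pi/2, pi/2[ already determines [E],
   by uniqueness of power series coefficients. *)
Definition euler_numbers (R : realType) (E : nat -> R) : Prop :=
  forall z : R, `|z| < pi / 2 ->
    (series (fun n => E n * (z ^+ n / n`!%:R)) : nat -> R) @ \oo
      --> 2 / (expR z + expR (- z)).

(* The parts of a composition of [n] are at most [n], so tuples over ['I_n.+1]
   include all of them. *)
Definition is_composition (n j : nat) (t : j.-tuple 'I_n.+1) : bool :=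
  [forall l : 'I_j, (1 <= tnth t l)%N] &&
  ((\sum_(l < j) (tnth t l : nat))%N == n).

Definition inner_sum (R : realType) (m p : nat) : R :=
  \sum_(1 <= k < p.+1)
    ((-1) ^+ k.+1 * 2 ^+ k / (2 * k + 1)%:R ^+ (2 * m + 1)) *
    'C(p - 1, k - 1)%:R.

Definition coefficient (R : realType) (m r n : nat) : R :=
  \sum_(1 <= j < n.+1)
    'C(r + j - 1, j)%:R *
    \sum_(t : j.-tuple 'I_n.+1 | is_composition t)
      \prod_(l < j) inner_sum R m (tnth t l).

(* Main.v *)
Require Import Defs.
From HB Require Import structures.
From mathcomp Require Import all_boot all_order all_algebra.
From mathcomp Require Import all_classical all_reals all_analysis.
From mathcomp Require Import ring lra zify.

Set Implicit Arguments.
Unset Strict Implicit.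
Unset Printing Implicit Defensive.

Import Order.TTheory GRing.Theory Num.Theory.
Import numFieldNormedType.Exports.

Local Open Scope classical_set_scope.
Local Open Scope ring_scope.

(** The left-hand side is [beta(s) ^- r], where [s = 2m+1] and
    [beta(s) = \sum_k (-1)^k / (2k+1)^s] is the Dirichlet beta function, and the
    right-hand side is the expansion of the same power in Euler-transformed
    coefficients.

    Evaluation of beta ([euler_number_beta]).  Integrating [cosh (x t)] against
    the kernel [\sum_(k < N) cos ((2k+1) t) = sin (2 N t) / (2 sin t)] over
    [[0, pi/2]] produces [cosh (pi x / 2)] times the [N]-th partial sum of
    [\sum_k (-1)^k (2k+1) / ((2k+1)^2 + x^2)].  As [(cosh (x t) - 1) / sin t] is
    smooth, the Riemann-Lebesgue lemma says that only the value of [cosh (x t)]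
    at [t = 0] matters in the limit, so that the product tends to its value at
    [x = 0], the Leibniz series [pi/4] ([sech_sum_cvg]).  Expanding each fraction
    in powers of [x] gives the Taylor series of [pi / (4 cosh (pi x / 2))], whose
    coefficients are [(-1)^i beta(2i+1)] ([sech_power_series]); they agree with
    the ones given by the Euler numbers, by uniqueness of power series
    coefficients.

    Euler transformation ([euler_transform], [series_inner_sum]).  Write [b_p]
    for the bracketed inner sums.  With [u = w / (1 - w)], formally
    [\sum_p b_p w^p = \sum_(k >= 1) (-1)^(k+1) (2 u)^k / (2k+1)^s], and [w = 1/3]
    is the point where [2 u = 1]; hence [\sum_p b_p / 3^p = 1 - beta(s)].

    Powers ([cvg_inv_pow]).  The coefficient of [3^-n] in the statement is the
    coefficient of [X^n] in [(1 - \sum_p b_p X^p)^-r], and at [X = 1/3] this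
    series is [beta(s)^-r].

    Positivity ([log_moment_gt0]).  All [b_p] are positive, which makes the
    coefficients positive and lets the convergence of the last series follow
    from monotonicity of its partial sums.  Up to a factor 2, [b_(q+1)] is a
    moment of [x^2 (1 - 2 x^2)^q]; a first-order recurrence in [q] propagates
    positivity from exponent [s] to [s+1], and the case [s = 2] is settled by a
    lower bound for [s = 1]. *)

(** * Derivatives and a mean value inequality *)

(** The pointwise forms below let unification find the summands inside an
    explicit [fun], which the versions stated with operations on functions do
    not. *)
Lemma is_deriveD_fun (R : realType) (f g : R -> R) (x a b : R) :
  is_derive x 1 f a -> is_derive x 1 g b ->
  is_derive x 1 (fun t => f t + g t) (a + b).
Proof. by move=> ? ?; exact: is_deriveD. Qed.

Lemma is_deriveB_fun (R : realType) (f g : R -> R) (x a b : R) :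
  is_derive x 1 f a -> is_derive x 1 g b ->
  is_derive x 1 (fun t => f t - g t) (a - b).
Proof. by move=> ? ?; exact: is_deriveB. Qed.

Lemma is_deriveM_fun (R : realType) (f g : R -> R) (x a b : R) :
  is_derive x 1 f a -> is_derive x 1 g b ->
  is_derive x 1 (fun t => f t * g t) (f x * b + g x * a).
Proof. by move=> ? ?; exact: is_deriveM. Qed.

Lemma is_deriveZ_fun (R : realType) (f : R -> R) (k x a : R) :
  is_derive x 1 f a -> is_derive x 1 (fun t => k * f t) (k * a).
Proof. by move=> ?; exact: is_deriveZ. Qed.

Lemma is_derive_sum_fun (R : realType) n (f : nat -> R -> R) (x : R) (a : nat -> R) :
  (forall i, is_derive x 1 (f i) (a i)) ->
  is_derive x 1 (fun t => \sum_(i < n) f i t) (\sum_(i < n) a i).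
Proof.
move=> h; elim: n => [|n IH].
  under eq_fun do rewrite big_ord0.
  by rewrite big_ord0; exact: is_derive_cst.
under eq_fun do rewrite big_ord_recr /=.
by rewrite big_ord_recr /=; exact: is_deriveD_fun.
Qed.

Lemma is_derive_comp_lin (R : realType) (f : R -> R) (k x a : R) :
  is_derive (k * x) 1 f a -> is_derive x 1 (fun t => f (k * t)) (k * a).
Proof.
move=> h; have hk : is_derive x 1 (fun t => k * t) (k * 1) by apply: is_deriveZ_fun.
by rewrite mulrC -[k in a * k]mulr1; exact: (is_derive1_comp h hk).
Qed.

(** Replaces integration throughout: estimates of integrals become
    comparisons between antiderivatives, and follow from the mean value theorem
    applied to [g + f] and [g - f]. *)
Lemma dist_le_of_derive_le (R : realType) (f df g dg : R -> R) (a b : R) :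
  a <= b -> (forall x, a <= x <= b -> is_derive x 1 f (df x)) ->
  (forall x, a <= x <= b -> is_derive x 1 g (dg x)) ->
  (forall x, a <= x <= b -> `|df x| <= dg x) -> `|f b - f a| <= g b - g a.
Proof.
move=> ab hf hg hle.
have mvt (h dh : R -> R) : (forall x, a <= x <= b -> is_derive x 1 h (dh x)) ->
    (forall x, a <= x <= b -> 0 <= dh x) -> 0 <= h b - h a.
  move=> hh h0; have [||c] := @MVT_segment _ h dh a b ab.
  - by move=> x; rewrite in_itv /= => /andP[/ltW ax /ltW xb]; apply: hh; rewrite ax.
  - apply: derivable_within_continuous => x; rewrite in_itv /= => xab.
    by have [] := hh _ xab.
  rewrite in_itv /= => cab ->.
  by rewrite mulr_ge0 ?subr_ge0// h0.
have hD : 0 <= (g b + f b) - (g a + f a).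
  apply: (mvt (fun t => g t + f t) (fun x => dg x + df x)) => x xab.
    by apply: is_deriveD_fun; [exact: hg|exact: hf].
  by have := hle x xab; rewrite ler_norml => /andP[]; lra.
have hB : 0 <= (g b - f b) - (g a - f a).
  apply: (mvt (fun t => g t - f t) (fun x => dg x - df x)) => x xab.
    by apply: is_deriveB_fun; [exact: hg|exact: hf].
  by have := hle x xab; rewrite ler_norml => /andP[]; lra.
by rewrite ler_norml; apply/andP; split; lra.
Qed.

(** * Alternating series and the Dirichlet beta function *)

(** Induction on the length works because the sum from [n] is [a n] minus the
    sum from [n+1], which lies between [0] and [a n.+1]. *)
Lemma alternating_sum_bounds (R : realDomainType) (a : nat -> R) n M :
  (forall k, 0 <= a k) -> (forall k, a k.+1 <= a k) ->
  0 <= \sum_(i < M) (- 1) ^+ i * a (n + i)%N <= a n.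
Proof.
move=> a0 am; elim: M n => [|M IH] n; first by rewrite big_ord0 lexx a0.
rewrite big_ord_recl /= expr0 mul1r addn0.
have -> : \sum_(i < M) (- 1) ^+ bump 0 i * a (n + bump 0 i)%N =
    - \sum_(i < M) (- 1) ^+ i * a (n.+1 + i)%N.
  rewrite -sumrN; apply: eq_bigr => i _.
  by rewrite /bump /= add1n exprS addnS addSn; ring.
by have := IH n.+1; have := am n; lra.
Qed.

Lemma alternating_sum_dist (R : realDomainType) (a : nat -> R) n M :
  (forall k, 0 <= a k) -> (forall k, a k.+1 <= a k) ->
  `|\sum_(i < n + M) (- 1) ^+ i * a i - \sum_(i < n) (- 1) ^+ i * a i| <= a n.
Proof.
move=> a0 am; rewrite big_split_ord /= addrAC subrr add0r.
have -> : \sum_(i < M) (- 1) ^+ (n + i) * a (n + i)%N =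
   (- 1) ^+ n * \sum_(i < M) (- 1) ^+ i * a (n + i)%N.
  by rewrite mulr_sumr; apply: eq_bigr => i _; rewrite exprD mulrA.
rewrite normrM normrX normrN1 expr1n mul1r.
by have /andP[h ?] := alternating_sum_bounds n M a0 am; rewrite ger0_norm.
Qed.

Lemma alternating_series (R : realType) (a : nat -> R) :
  (forall k, 0 <= a k) -> (forall k, a k.+1 <= a k) -> a @ \oo --> (0 : R) ->
  exists L, ((fun n => \sum_(i < n) (- 1) ^+ i * a i) @ \oo --> L) /\
    forall n, `|\sum_(i < n) (- 1) ^+ i * a i - L| <= a n.
Proof.
move=> a0 am ha; set S := fun n : nat => \sum_(i < n) (- 1) ^+ i * a i.
have cS : cvgn S.
  apply/cauchy_cvgP/cauchy_ballP => e e0.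
  move/cvgrPdist_lt: ha => /(_ (e / 2)) []; first by rewrite divr_gt0.
  move=> N _ hN; rewrite near_map2 /=.
  have hd n : (N <= n)%N -> `|S n - S N| < e / 2.
    move=> Nn; rewrite -(subnKC Nn); apply: le_lt_trans (alternating_sum_dist _ _ a0 am) _.
    by have := hN N (leqnn N); rewrite sub0r normrN ger0_norm.
  exists ([set n | (N <= n)%N], [set n | (N <= n)%N]) => /=.
    by split; exists N.
  move=> [n p] /= [Nn Np]; rewrite -ball_normE /=.
  have -> : S n - S p = (S n - S N) - (S p - S N) by ring.
  by apply: le_lt_trans (ler_normB _ _) _; have := hd _ Nn; have := hd _ Np; lra.
exists (lim (S @ \oo)); split=> // n.
have h : (fun M => `|S (n + M)%N - S n|) @ \oo --> `|lim (S @ \oo) - S n|.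
  apply: cvg_norm; apply: cvgB; last exact: cvg_cst.
  have h1 : [sequence S (M + n)%N]_M @ \oo --> lim (S @ \oo) by rewrite cvg_shiftn.
  by under eq_fun do rewrite addnC; exact: h1.
rewrite distrC -(cvg_lim _ h)//; apply: limr_le; first exact: cvgP h.
by apply: nearW => M; exact: alternating_sum_dist.
Qed.

Definition inv_odd (R : realType) (s k : nat) : R := ((2 * k + 1)%:R ^+ s)^-1.

Lemma inv_odd_ge0 (R : realType) s k : 0 <= inv_odd R s k.
Proof. by rewrite invr_ge0 exprn_ge0. Qed.

Lemma inv_odd_noninc (R : realType) s k : inv_odd R s k.+1 <= inv_odd R s k.
Proof.
rewrite lef_pV2 ?posrE ?exprn_gt0 ?ltr0n ?addn1//.
by rewrite lerXn2r ?nnegrE// ler_nat; lia.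
Qed.

Lemma inv_odd_le (R : realType) s k : inv_odd R s.+1 k <= harmonic k.
Proof.
rewrite /harmonic /= lef_pV2 ?posrE ?exprn_gt0 ?ltr0n ?addn1//.
by rewrite -natrX ler_nat (leq_trans _ (leq_pexp2l _ (ltn0Sn s)))//; lia.
Qed.

Lemma inv_odd_cvg0 (R : realType) s : inv_odd R s.+1 @ \oo --> (0 : R).
Proof.
apply: squeeze_cvgr (cvg_cst 0) (@cvg_harmonic R).
by apply: nearW => k; rewrite inv_odd_ge0 inv_odd_le.
Qed.

Definition dirichlet_beta_sum (R : realType) (s n : nat) : R :=
  \sum_(k < n) (- 1) ^+ k * inv_odd R s k.

(** The limit is meaningful for [s >= 1]; for [s = 0] the series diverges. *)
Definition dirichlet_beta (R : realType) (s : nat) : R := lim (dirichlet_beta_sum R s @ \oo).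

Lemma dirichlet_beta_sum_dist (R : realType) s n :
  `|dirichlet_beta_sum R s.+1 n - dirichlet_beta R s.+1| <= inv_odd R s.+1 n.
Proof.
have [L [hL h]] := alternating_series (@inv_odd_ge0 R s.+1)
  (@inv_odd_noninc R s.+1) (@inv_odd_cvg0 R s).
by rewrite /dirichlet_beta (cvg_lim _ hL)//; exact: h.
Qed.

Lemma dirichlet_beta_sum_cvg (R : realType) s :
  dirichlet_beta_sum R s.+1 @ \oo --> dirichlet_beta R s.+1.
Proof.
have [L [hL h]] := alternating_series (@inv_odd_ge0 R s.+1)
  (@inv_odd_noninc R s.+1) (@inv_odd_cvg0 R s).
by rewrite /dirichlet_beta (cvg_lim _ hL).
Qed.

(** The derivative of [atan] minus its [n]-th Taylor polynomial is, up to sign,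
    [x^(2n) / (1 + x^2)], which is dominated by the derivative of
    [x^(2n+1) / (2n+1)]. *)
Lemma dirichlet_beta1 (R : realType) : dirichlet_beta R 1 = pi / 4.
Proof.
pose p n (x : R) := \sum_(k < n) (- 1) ^+ k * (inv_odd R 1 k * x ^+ (2 * k + 1)).
pose dp n (x : R) := \sum_(k < n) (- 1) ^+ k * x ^+ (2 * k).
have dX k (x : R) : is_derive x 1
    (fun t : R => inv_odd R 1 k * t ^+ (2 * k + 1)) (x ^+ (2 * k)).
  rewrite [X in is_derive _ _ X _](_ : _ = horner (inv_odd R 1 k *: 'X^(2 * k + 1))).
    apply: is_derive_eq; rewrite derivZ derivXn hornerZ hornerMn hornerXn /inv_odd expr1.
    rewrite addn1 /=. by rewrite -[x ^+ _ *+ _]mulr_natl mulKf// pnatr_eq0.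
  by apply/funext => t; rewrite hornerZ hornerXn.
have dpE n (x : R) : is_derive x 1 (p n) (dp n x).
  by apply: (is_derive_sum_fun n
    (f := fun k x => (- 1) ^+ k * (inv_odd R 1 k * x ^+ (2 * k + 1)))).
have geo n (x : R) : (1 + x ^+ 2) * dp n x = 1 - (- 1) ^+ n * x ^+ (2 * n).
  rewrite /dp; elim: n => [|n IH]; first by rewrite big_ord0 mulr0 !expr0 mulr1 subrr.
  by rewrite big_ord_recr /= mulrDr IH mulnS !exprD !exprS; ring.
have pos (x : R) : 0 < 1 + x ^+ 2 by rewrite ltr_pwDl// sqr_ge0.
have bnd n : `|atan 1 - p n 1| <= inv_odd R 1 n.
  have := @dist_le_of_derive_le R (fun x => atan x - p n x)
    (fun x => (1 + x ^+ 2)^-1 - dp n x)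
    (fun x => inv_odd R 1 n * x ^+ (2 * n + 1)) (fun x => x ^+ (2 * n)) 0 1 ler01.
  rewrite atan0 expr1n mulr1 expr0n addn1 /= mulr0 subr0.
  rewrite (_ : p n 0 = 0) ?subr0; last first.
    by rewrite /p big1// => k _; rewrite expr0n addn1 /= !mulr0.
  apply => // x x01.
  - by have := dX n x; rewrite addn1.
  - have -> : (1 + x ^+ 2)^-1 - dp n x = (- 1) ^+ n * x ^+ (2 * n) / (1 + x ^+ 2).
      rewrite -[dp n x](mulKf (_ : 1 + x ^+ 2 != 0)) ?gt_eqF// geo.
      by field; rewrite gt_eqF.
    rewrite !normrM normrX normrN1 expr1n mul1r normfV (gtr0_norm (pos x)).
    rewrite ger0_norm; last by rewrite exprM exprn_ge0// sqr_ge0.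
    rewrite ler_pdivrMr// ler_peMr ?lerDl ?sqr_ge0//.
    by rewrite exprM exprn_ge0// sqr_ge0.
have e n : p n 1 = dirichlet_beta_sum R 1 n.
  by apply: eq_bigr => k _; rewrite expr1n mulr1.
rewrite -atan1 /dirichlet_beta; apply: cvg_lim => //.
apply/cvgrPdist_le => eps eps0.
move/cvgrPdist_le : (@inv_odd_cvg0 R 0) => /(_ _ eps0).
apply: filterS => n; rewrite sub0r normrN => h.
by rewrite -e (le_trans (bnd n))// (le_trans (ler_norm _)).
Qed.

(** * Partial fractions of the hyperbolic secant *)

Definition cosh_lin (R : realType) (x t : R) : R := (expR (x * t) + expR (- x * t)) / 2.
Definition sinh_lin (R : realType) (x t : R) : R := (expR (x * t) - expR (- x * t)) / 2.

Lemma is_derive_cosh_lin (R : realType) (x t : R) :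
  is_derive t 1 (cosh_lin x) (x * sinh_lin x t).
Proof.
have h := is_deriveZ_fun 2^-1 (is_deriveD_fun
  (is_derive_comp_lin (is_derive_expR (x * t)))
  (is_derive_comp_lin (is_derive_expR (- x * t)))).
rewrite [X in is_derive _ _ X _](_ : _ =
  fun t => 2^-1 * (expR (x * t) + expR (- x * t))); last first.
  by apply/funext => u; rewrite /cosh_lin mulrC.
by apply: is_derive_eq; rewrite /sinh_lin; field.
Qed.

Lemma is_derive_sinh_lin (R : realType) (x t : R) :
  is_derive t 1 (sinh_lin x) (x * cosh_lin x t).
Proof.
have h := is_deriveZ_fun 2^-1 (is_deriveB_fun
  (is_derive_comp_lin (is_derive_expR (x * t)))
  (is_derive_comp_lin (is_derive_expR (- x * t)))).
rewrite [X in is_derive _ _ X _](_ : _ =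
  fun t => 2^-1 * (expR (x * t) - expR (- x * t))); last first.
  by apply/funext => u; rewrite /sinh_lin mulrC.
by apply: is_derive_eq; rewrite /cosh_lin; field.
Qed.

Lemma cosh_lin_le (R : realType) (x t : R) : `|x| <= 1 -> 0 <= t <= pi / 2 ->
  `|cosh_lin x t| <= expR 2.
Proof.
move=> x1 /andP[t0 tpi].
have xt : `|x * t| <= 2.
  rewrite normrM (ger0_norm t0) (le_trans (ler_wpM2r t0 x1))// mul1r.
  by rewrite (le_trans tpi)// ltW// pihalf_lt2.
have h1 : expR (x * t) <= expR 2 by rewrite ler_expR (le_trans (ler_norm _)).
have h2 : expR (- x * t) <= expR 2.
  by rewrite ler_expR mulNr (le_trans (ler_norm _))// normrN.
have h3 := expR_gt0 (x * t); have h4 := expR_gt0 (- x * t).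
by rewrite /cosh_lin ger0_norm; lra.
Qed.

Lemma sinh_lin_le (R : realType) (x t : R) : `|x| <= 1 -> 0 <= t <= pi / 2 ->
  `|sinh_lin x t| <= expR 2 * t.
Proof.
move=> x1 /andP[t0 tpi].
have := @dist_le_of_derive_le R (sinh_lin x) _ (fun u => expR 2 * u) (fun=> expR 2) 0 t t0
  (fun u _ => is_derive_sinh_lin x u).
rewrite {2}/sinh_lin !mulr0 subrr mul0r !subr0; apply.
  by move=> u _; rewrite -[X in is_derive _ _ _ X]mulr1; exact: is_deriveZ_fun.
move=> u /andP[u0 ut]; rewrite normrM -[leRHS]mul1r ler_pM//.
by apply: cosh_lin_le => //; rewrite u0 (le_trans ut).
Qed.

Lemma cosh_lin_sub1_le (R : realType) (x t : R) : `|x| <= 1 -> 0 <= t <= pi / 2 ->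
  `|cosh_lin x t - 1| <= expR 2 * t ^+ 2.
Proof.
move=> x1 /andP[t0 tpi].
have := @dist_le_of_derive_le R (cosh_lin x) _ (fun u => expR 2 * t * u)
   (fun=> expR 2 * t) 0 t t0 (fun u _ => is_derive_cosh_lin x u).
rewrite {2}/cosh_lin !mulr0 expR0 subr0 (_ : (1 + 1) / 2 = 1 :> R); last by field.
rewrite -mulrA -expr2; apply.
  by move=> u _; rewrite -[X in is_derive _ _ _ X]mulr1; exact: is_deriveZ_fun.
move=> u /andP[u0 ut]; rewrite normrM -[leRHS]mul1r ler_pM//.
apply: le_trans (sinh_lin_le x1 _) _; first by rewrite u0 (le_trans ut).
by rewrite ler_wpM2l ?expR_ge0.
Qed.

(** [sin t = 2 sin (t/2) cos (t/2) >= t cos^2 (t/2) = t (1 + cos t) / 2]. *)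
Lemma sin_ge_half (R : realType) (t : R) : 0 <= t <= pi / 2 -> t / 2 <= sin t.
Proof.
move=> /andP[t0 tpi]; set u := t / 2.
have u0 : 0 <= u by rewrite divr_ge0.
have upi : u <= pi / 2 by rewrite /u; lra.
have cu : 0 <= cos u.
  by apply: cos_ge0_pihalf; rewrite upi andbT; have := pi_ge0 R; lra.
have su : cos u * u <= sin u.
  have [|c] := @MVT_segment R sin cos 0 u u0 (fun x _ => is_derive_sin x).
    by apply: derivable_within_continuous => x _; exact: derivable_sin.
  rewrite in_itv /= sin0 !subr0 => /andP[c0 cu'] ->.
  rewrite ler_wpM2r//.
  move: cu'; rewrite le_eqVlt => /predU1P[->//|cu'].
  by apply/ltW; rewrite ltr_cos ?in_itv /= ?c0 ?u0 /=; have := pi_ge0 R; lra.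
have ct : 0 <= cos t.
  by apply: cos_ge0_pihalf; rewrite tpi andbT; have := pi_ge0 R; lra.
have e : t = u + u by rewrite /u; field.
have es : sin t = 2 * (sin u * cos u) by rewrite e sinD; ring.
have ec : cos t = 2 * cos u ^+ 2 - 1.
  by rewrite e cosD -!expr2 sin2cos2; ring.
rewrite es; have := ler_wpM2r cu su.
have : u <= 2 * (cos u * u * cos u).
  have -> : 2 * (cos u * u * cos u) = (2 * cos u ^+ 2) * u by ring.
  by rewrite ler_peMl//; lra.
lra.
Qed.

Lemma dirichlet_kernel (R : realType) (t : R) N :
  2 * sin t * (\sum_(k < N) cos ((2 * k + 1)%:R * t)) = sin ((2 * N)%:R * t).
Proof.
elim: N => [|N IH]; first by rewrite big_ord0 mulr0 muln0 mul0r sin0.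
rewrite big_ord_recr /= mulrDr IH mulnS.
have -> : (2 + 2 * N)%:R * t = (2 * N + 1)%:R * t + t by rewrite !natrD; ring.
have -> : (2 * N)%:R * t = (2 * N + 1)%:R * t - t by rewrite !natrD; ring.
by rewrite !sinD sinN cosN; ring.
Qed.

(** Partial sums of the partial fraction expansion of
    [pi / (4 cosh (pi x / 2))]. *)
Definition sech_sum (R : realType) (x : R) (N : nat) : R :=
  \sum_(k < N) (- 1) ^+ k * ((2 * k + 1)%:R / ((2 * k + 1)%:R ^+ 2 + x ^+ 2)).

(** The antiderivative of [t |-> cosh (x t) cos ((2k+1) t)] that vanishes at 0. *)
Definition cosh_cos_primitive (R : realType) (x : R) (k : nat) (t : R) : R :=
  (x * (sinh_lin x t * cos ((2 * k + 1)%:R * t)) +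
   (2 * k + 1)%:R * (cosh_lin x t * sin ((2 * k + 1)%:R * t)))
  / ((2 * k + 1)%:R ^+ 2 + x ^+ 2).

Lemma is_derive_cosh_cos_primitive (R : realType) (x : R) (k : nat) (t : R) :
  is_derive t 1 (cosh_cos_primitive x k) (cosh_lin x t * cos ((2 * k + 1)%:R * t)).
Proof.
rewrite /cosh_cos_primitive; set a := (2 * k + 1)%:R.
have d0 : a ^+ 2 + x ^+ 2 != 0.
  by rewrite gt_eqF// ltr_wpDr ?sqr_ge0// exprn_gt0// /a ltr0n addn1.
have hc := is_derive_comp_lin (is_derive_cos (a * t)).
have hs := is_derive_comp_lin (is_derive_sin (a * t)).
have h1 := is_deriveZ_fun x (is_deriveM_fun (is_derive_sinh_lin x t) hc).
have h2 := is_deriveZ_fun a (is_deriveM_fun (is_derive_cosh_lin x t) hs).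
have h := is_deriveZ_fun (a ^+ 2 + x ^+ 2)^-1 (is_deriveD_fun h1 h2).
rewrite [X in is_derive _ _ X _](_ : _ = fun t => (a ^+ 2 + x ^+ 2)^-1 *
  (x * (sinh_lin x t * cos (a * t)) + a * (cosh_lin x t * sin (a * t)))); last first.
  by apply/funext => u; rewrite mulrC.
by apply: is_derive_eq; field; rewrite -natrM natr1 -addn1.
Qed.

Lemma cos_odd_pihalf (R : realType) k : cos ((2 * k + 1)%:R * (pi / 2) : R) = 0.
Proof.
elim: k => [|k IH]; first by rewrite muln0 mul1r cos_pihalf.
have -> : (2 * k.+1 + 1)%:R * (pi / 2) = (2 * k + 1)%:R * (pi / 2) + pi :> R.
  by rewrite mulnS !natrD; field.
by rewrite cosDpi IH oppr0.
Qed.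

Lemma sin_odd_pihalf (R : realType) k :
  sin ((2 * k + 1)%:R * (pi / 2) : R) = (- 1) ^+ k.
Proof.
elim: k => [|k IH]; first by rewrite muln0 mul1r sin_pihalf.
have -> : (2 * k.+1 + 1)%:R * (pi / 2) = (2 * k + 1)%:R * (pi / 2) + pi :> R.
  by rewrite mulnS !natrD; field.
by rewrite sinDpi IH exprS mulN1r.
Qed.

Lemma sum_primitive_pihalf (R : realType) (x : R) N :
  \sum_(k < N) cosh_cos_primitive x k (pi / 2) = cosh_lin x (pi / 2) * sech_sum x N.
Proof.
rewrite mulr_sumr; apply: eq_bigr => k _; rewrite /cosh_cos_primitive.
by rewrite cos_odd_pihalf sin_odd_pihalf; ring.
Qed.

Lemma sum_primitive_0 (R : realType) (x : R) N :
  \sum_(k < N) cosh_cos_primitive x k 0 = 0.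
Proof.
rewrite big1// => k _; rewrite /cosh_cos_primitive /sinh_lin !mulr0 sin0.
by rewrite subrr mul0r; ring.
Qed.

Lemma cosh_lin0 (R : realType) (t : R) : cosh_lin 0 t = 1.
Proof. by rewrite /cosh_lin oppr0 mul0r expR0; field. Qed.

(** The left-hand side is the integral over [[0, pi/2]] of
    [(cosh (x t) - 1) sin (2 N t) / (2 sin t)], which one integration by parts
    makes [O(1/N)].  The integration by parts is carried out on antiderivatives,
    on [[e, pi/2]] with [e] tending to 0, so that the quotient
    [(cosh (x t) - 1) / (2 sin t)] and its derivative are only needed where
    [sin t > 0]; both stay bounded there since [cosh (x t) - 1 = O(t^2)]. *)
Lemma riemann_lebesgue_cosh (R : realType) (x : R) N : `|x| <= 1 -> (0 < N)%N ->
  `|cosh_lin x (pi / 2) * sech_sum x N - sech_sum 0 N| <= 5 * expR 2 / N%:R.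
Proof.
move=> x1 N0; set K := expR 2; have K0 : 0 < K by exact: expR_gt0.
have NR : 0 < N%:R :> R by rewrite ltr0n.
have pi2 := pihalf_02 R.
pose G t : R := \sum_(k < N) (cosh_cos_primitive x k t - cosh_cos_primitive 0 k t).
pose h t : R := (cosh_lin x t - 1) * (2 * sin t)^-1.
pose dh t : R := x * sinh_lin x t * (2 * sin t)^-1
   - (cosh_lin x t - 1) * (2 * cos t) / (2 * sin t) ^+ 2.
pose c t : R := cos ((2 * N)%:R * t) / (2 * N)%:R.
have N2 : (2 * N)%:R != 0 :> R by rewrite pnatr_eq0 muln_eq0 -lt0n.
have dG (t : R) : is_derive t 1 G
   ((cosh_lin x t - 1) * \sum_(k < N) cos ((2 * k + 1)%:R * t)).
  rewrite mulr_sumr.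
  apply: (is_derive_sum_fun N
    (f := fun k t => cosh_cos_primitive x k t - cosh_cos_primitive 0 k t)
    (a := fun k => (cosh_lin x t - 1) * cos ((2 * k + 1)%:R * t))) => k.
  rewrite mulrBl -[X in _ - X * _](cosh_lin0 t).
  by apply: is_deriveB_fun; exact: is_derive_cosh_cos_primitive.
have sinP (t : R) : 0 < t <= pi / 2 -> 0 < sin t.
  move=> /andP[t0 tpi]; have := @sin_ge_half R t.
  by rewrite tpi (ltW t0) => /(_ isT); lra.
have dhP (t : R) : 0 < t <= pi / 2 -> is_derive t 1 h (dh t).
  move=> tp; have s0 := sinP _ tp.
  have s2 : 2 * sin t != 0 by rewrite mulf_neq0// gt_eqF.
  have h1 := is_deriveB_fun (is_derive_cosh_lin x t) (is_derive_cst (1 : R) t 1).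
  have h2 := @is_deriveV R (fun u => 2 * sin u) t _ 1 s2 (is_deriveZ_fun 2 (is_derive_sin t)).
  have h3 := is_deriveM_fun h1 h2.
  apply: is_derive_eq; rewrite /dh /cst /GRing.scale /=; field.
  by rewrite gt_eqF.
have dc (t : R) : is_derive t 1 c (- sin ((2 * N)%:R * t)).
  have h1 := is_deriveZ_fun (2 * N)%:R^-1
    (is_derive_comp_lin (is_derive_cos ((2 * N)%:R * t))).
  rewrite [X in is_derive _ _ X _](_ : _ =
      fun t => (2 * N)%:R^-1 * cos ((2 * N)%:R * t)); last first.
    by apply/funext => u; rewrite /c mulrC.
  by apply: is_derive_eq; rewrite mulKf.
(* In the derivative of [G + h c] the oscillating terms cancel by
   [dirichlet_kernel]; what is left carries the factor [c = O(1/N)]. *)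
have dW (t : R) : 0 < t <= pi / 2 -> is_derive t 1 (fun t => G t + h t * c t) (dh t * c t).
  move=> tp; have s0 := sinP _ tp.
  have h1 := is_deriveD_fun (dG t) (is_deriveM_fun (dhP _ tp) (dc t)).
  apply: is_derive_eq; rewrite -(dirichlet_kernel t N) /h; field.
  by rewrite gt_eqF.
have cle (t : R) : `|c t| <= (2 * N%:R)^-1.
  rewrite /c normrM normfV natrM (ger0_norm (_ : 0 <= 2 * N%:R)) ?mulr_ge0//.
  by rewrite ler_piMl ?invr_ge0 ?mulr_ge0// ler_norml cos_geN1 cos_le1.
have hle (t : R) : 0 < t <= pi / 2 -> `|h t| <= 2 * K.
  move=> /[dup] tp /andP[t0 tpi]; have s0 := sinP _ tp.
  have st : t / 2 <= sin t by apply: sin_ge_half; rewrite ltW.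
  rewrite /h normrM normfV (gtr0_norm (_ : 0 < 2 * sin t)) ?mulr_gt0//.
  rewrite ler_pdivrMr ?mulr_gt0//.
  apply: le_trans (cosh_lin_sub1_le x1 _) _; first by rewrite ltW.
  rewrite -/K (_ : 2 * K * (2 * sin t) = K * (4 * sin t)); last by ring.
  by rewrite ler_wpM2l ?(ltW K0)//; nra.
have dhle (t : R) : 0 < t <= pi / 2 -> `|dh t| <= 3 * K.
  move=> /[dup] tp /andP[t0 tpi]; have s0 := sinP _ tp.
  have st : t / 2 <= sin t by apply: sin_ge_half; rewrite ltW.
  have tp' : 0 <= t <= pi / 2 by rewrite ltW.
  have s2 : 0 < 2 * sin t by rewrite mulr_gt0.
  rewrite /dh (_ : 3 * K = K + 2 * K); last ring.
  apply: le_trans (ler_normB _ _) _; apply: lerD.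
    rewrite normrM normfV (gtr0_norm s2) ler_pdivrMr// normrM.
    apply: (@le_trans _ _ (1 * (K * t))); first by rewrite ler_pM// sinh_lin_le.
    by rewrite mul1r ler_wpM2l ?(ltW K0)//; lra.
  rewrite normrM normfV (gtr0_norm (exprn_gt0 _ s2)) ler_pdivrMr ?exprn_gt0// normrM.
  apply: (@le_trans _ _ ((K * t ^+ 2) * 2)).
    rewrite ler_pM// ?cosh_lin_sub1_le// normrM ger0_norm// ler_piMr//.
    by rewrite ler_norml cos_geN1 cos_le1.
  rewrite (_ : K * t ^+ 2 * 2 = K * (2 * t ^+ 2)); last by ring.
  rewrite (_ : 2 * K * (2 * sin t) ^+ 2 = K * (8 * sin t ^+ 2)); last by ring.
  by rewrite ler_wpM2l ?(ltW K0)//; nra.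
have main (e : R) : 0 < e <= pi / 2 -> `|G (pi / 2) - G e| <= 5 * K / N%:R.
  move=> /[dup] ep /andP[e0 epi].
  have W : `|(G (pi / 2) + h (pi / 2) * c (pi / 2)) - (G e + h e * c e)| <=
     3 * K / (2 * N%:R) * (pi / 2) - 3 * K / (2 * N%:R) * e.
    have tP t : e <= t <= pi / 2 -> 0 < t <= pi / 2.
      by move=> /andP[et ->]; rewrite (lt_le_trans e0).
    have dL t : e <= t <= pi / 2 ->
        is_derive t 1 (fun t => 3 * K / (2 * N%:R) * t) (3 * K / (2 * N%:R)).
      by move=> _; rewrite -[X in is_derive _ _ _ X]mulr1; exact: is_deriveZ_fun.
    have dle t : e <= t <= pi / 2 -> `|dh t * c t| <= 3 * K / (2 * N%:R).
      by move=> /tP tp; rewrite normrM ler_pM// dhle.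
    exact: (dist_le_of_derive_le epi (fun t tp => dW t (tP t tp)) dL dle).
  have b1 : `|h (pi / 2) * c (pi / 2)| <= 2 * K * (2 * N%:R)^-1.
    by rewrite normrM ler_pM// hle//; lra.
  have b2 : `|h e * c e| <= 2 * K * (2 * N%:R)^-1 by rewrite normrM ler_pM// hle.
  have -> : 5 * K / N%:R = 10 * (K / (2 * N%:R)) by field; rewrite gt_eqF.
  set q := K / (2 * N%:R) in W b1 b2 *.
  have q0 : 0 <= q by rewrite divr_ge0 ?mulr_ge0 ?ltW.
  have b3 : 3 * K / (2 * N%:R) * (pi / 2) - 3 * K / (2 * N%:R) * e <= 6 * q.
    rewrite -mulrBr -(mulrA 3) -/q; nra.
  move: W b1 b2 b3; rewrite -(mulrA 2 K) -/q.
  move=> W b1 b2 b3; have W' := le_trans W b3.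
  move: W' b1 b2; rewrite !ler_norml => /andP[? ?] /andP[? ?] /andP[? ?].
  by apply/andP; split; lra.
have GE (t : R) : G t = \sum_(k < N) cosh_cos_primitive x k t
    - \sum_(k < N) cosh_cos_primitive 0 k t by rewrite /G sumrB.
have Gpi : cosh_lin x (pi / 2) * sech_sum x N - sech_sum 0 N = G (pi / 2) - G 0.
  by rewrite !GE !sum_primitive_0 !subr0 !sum_primitive_pihalf cosh_lin0 mul1r.
rewrite Gpi.
(* [main] holds for every positive [e]; [G] is continuous at 0. *)
have cG : G t @[t --> (0 : R)^'+] --> G 0.
  apply: cvg_at_right_filter.
  have [/derivable1_diffP/differentiable_continuous] := dG 0; exact.
have cn : `|G (pi / 2) - G t| @[t --> (0 : R)^'+] --> `|G (pi / 2) - G 0|.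
  by apply: cvg_norm; apply: cvgB => //; exact: cvg_cst.
rewrite -(cvg_lim _ cn)//; apply: limr_le; first exact: cvgP cn.
near=> t; apply: main; apply/andP; split; first by near: t; exact: nbhs_right_gt.
by near: t; apply: nbhs_right_le; case/andP: pi2.
Unshelve. all: by end_near. Qed.

Lemma sech_sum_cvg (R : realType) (x : R) : `|x| <= 1 ->
  sech_sum x @ \oo --> pi / 4 / cosh_lin x (pi / 2).
Proof.
move=> x1.
have c0 : 0 < cosh_lin x (pi / 2).
  by rewrite divr_gt0// addr_gt0// expR_gt0.
have h0 : sech_sum (0 : R) @ \oo --> (pi / 4 : R).
  rewrite -dirichlet_beta1 (_ : sech_sum 0 = dirichlet_beta_sum R 1);
    first exact: dirichlet_beta_sum_cvg.
  apply/funext => N; apply: eq_bigr => k _; congr (_ * _); rewrite /inv_odd expr1.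
  by rewrite expr0n addr0 expr2 invfM mulVKf// pnatr_eq0 addn1.
have h1 : (fun N => cosh_lin x (pi / 2) * sech_sum x N - sech_sum 0 N) @ \oo --> (0 : R).
  apply/cvgrPdist_le => e e0.
  have hh : (fun n => 5 * expR 2 * harmonic n : R) @ \oo --> (5 * expR 2 * 0 : R).
    by apply: cvgMr; exact: cvg_harmonic.
  rewrite mulr0 in hh.
  move/cvgrPdist_le: hh => /(_ e e0) [N0 _ hN].
  exists N0.+1 => //= -[//|N] /= N0N; rewrite sub0r normrN.
  apply: le_trans (riemann_lebesgue_cosh x1 (ltn0Sn N)) _.
  have := hN N N0N; rewrite sub0r normrN; apply: le_trans.
  exact: ler_norm.
have h2 : (fun N => (cosh_lin x (pi / 2))^-1 *
   ((cosh_lin x (pi / 2) * sech_sum x N - sech_sum 0 N) + sech_sum 0 N)) @ \oo -->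
   (cosh_lin x (pi / 2))^-1 * (0 + pi / 4).
  by apply: cvgM; [exact: cvg_cst|apply: cvgD; [exact: h1|exact: h0]].
rewrite add0r [_ * (pi / 4)]mulrC in h2.
rewrite (_ : sech_sum x = fun N => (cosh_lin x (pi / 2))^-1 *
   ((cosh_lin x (pi / 2) * sech_sum x N - sech_sum 0 N) + sech_sum 0 N)); first exact: h2.
by apply/funext => N; rewrite subrK mulKf// gt_eqF.
Qed.

(** * Taylor expansion of the hyperbolic secant *)

Lemma geometric_expansion (R : realType) (a x : R) M : 0 < a ->
  a / (a ^+ 2 + x ^+ 2) =
  \sum_(i < M) (- 1) ^+ i * x ^+ (2 * i) * (a ^+ (2 * i + 1))^-1 +
  (- 1) ^+ M * x ^+ (2 * M) * (a / (a ^+ (2 * M) * (a ^+ 2 + x ^+ 2))).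
Proof.
move=> a0; have d0 : a ^+ 2 + x ^+ 2 != 0.
  by rewrite gt_eqF// ltr_wpDr ?sqr_ge0// exprn_gt0.
have an0 : a != 0 by rewrite gt_eqF.
elim: M => [|M IH]; first by rewrite big_ord0 muln0 !expr0 !mul1r add0r.
rewrite big_ord_recr /= -addrA IH; congr (_ + _).
rewrite mulnS !exprD [(- 1) ^+ M.+1]exprS expr1; field.
by rewrite an0 d0 expf_neq0.
Qed.

(** After expanding each fraction to order [M], the remainders again form an
    alternating sum of nonincreasing terms, so that their total is bounded by the
    first one uniformly in [N].  This uniformity is what allows [N] to tend to
    infinity before [M], although the double sum converges only conditionally. *)
Lemma sech_sum_expansion (R : realType) (x : R) M N :
  `|sech_sum x N -
    \sum_(i < M.+1) (- 1) ^+ i * x ^+ (2 * i) * dirichlet_beta_sum R (2 * i + 1) N|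
  <= x ^+ (2 * M.+1).
Proof.
pose a k : R := (2 * k + 1)%:R.
have a0 k : 0 < a k by rewrite ltr0n addn1.
have aS k : a k <= a k.+1 by rewrite ler_nat; lia.
pose rho k : R := (a k ^+ (2 * M + 1) * (a k ^+ 2 + x ^+ 2))^-1.
have pos k : 0 < a k ^+ 2 + x ^+ 2 by rewrite ltr_wpDr ?sqr_ge0// exprn_gt0.
have rho0 k : 0 <= rho k by rewrite invr_ge0 mulr_ge0 ?exprn_ge0 ?ltW.
have rhoS k : rho k.+1 <= rho k.
  rewrite lef_pV2 ?posrE ?mulr_gt0 ?exprn_gt0//.
  have pw n : a k ^+ n <= a k.+1 ^+ n by rewrite lerXn2r ?nnegrE// ltW.
  apply: ler_pM; [|exact: ltW|exact: pw|by rewrite lerD2r pw].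
  by rewrite exprn_ge0// ltW.
have -> : sech_sum x N -
    \sum_(i < M.+1) (- 1) ^+ i * x ^+ (2 * i) * dirichlet_beta_sum R (2 * i + 1) N
   = (- 1) ^+ M.+1 * x ^+ (2 * M.+1) * \sum_(k < N) (- 1) ^+ k * rho k.
  have -> : \sum_(i < M.+1) (- 1) ^+ i * x ^+ (2 * i) * dirichlet_beta_sum R (2 * i + 1) N =
     \sum_(k < N) (- 1) ^+ k *
       \sum_(i < M.+1) (- 1) ^+ i * x ^+ (2 * i) * (a k ^+ (2 * i + 1))^-1.
    under eq_bigr do rewrite /dirichlet_beta_sum mulr_sumr.
    rewrite exchange_big /=; apply: eq_bigr => k _; rewrite mulr_sumr.
    by apply: eq_bigr => i _; rewrite /inv_odd mulrCA.
  rewrite -sumrB mulr_sumr; apply: eq_bigr => k _.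
  rewrite -mulrBr (geometric_expansion x M.+1 (a0 k)) addrAC subrr add0r.
  rewrite mulrCA; congr (_ * (_ * _)); rewrite /rho.
  have -> : (2 * M.+1 = (2 * M + 1).+1)%N by rewrite mulnS addnC addn1 addn2.
  by rewrite exprS -mulrA invfM mulVKf// gt_eqF.
have /andP[s0 s1] := alternating_sum_bounds 0 N rho0 rhoS.
have x0 : 0 <= x ^+ (2 * M.+1) by rewrite exprM exprn_ge0// sqr_ge0.
rewrite !normrM normrX normrN1 expr1n mul1r (ger0_norm x0) (ger0_norm s0).
rewrite ler_piMr// (le_trans s1)// /rho /a muln0 add0n expr1n mul1r expr1n.
by rewrite invf_le1 ?lerDl ?sqr_ge0// ltr_pwDl ?sqr_ge0.
Qed.

Lemma sech_asymptotic (R : realType) (x : R) M : `|x| <= 1 ->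
  `|pi / 4 / cosh_lin x (pi / 2) -
    \sum_(i < M.+1) (- 1) ^+ i * x ^+ (2 * i) * dirichlet_beta R (2 * i + 1)|
  <= x ^+ (2 * M.+1).
Proof.
move=> x1.
have h : (fun N => `|sech_sum x N -
     \sum_(i < M.+1) (- 1) ^+ i * x ^+ (2 * i) * dirichlet_beta_sum R (2 * i + 1) N|) @ \oo -->
   `|pi / 4 / cosh_lin x (pi / 2) -
    \sum_(i < M.+1) (- 1) ^+ i * x ^+ (2 * i) * dirichlet_beta R (2 * i + 1)|.
  apply: cvg_norm; apply: cvgB; first exact: sech_sum_cvg.
  elim: M.+1 => [|K IH].
    by under eq_fun do rewrite big_ord0; rewrite big_ord0; exact: cvg_cst.
  under eq_fun do rewrite big_ord_recr /=.
  rewrite big_ord_recr /=; apply: cvgD; first exact: IH.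
  by apply: cvgMr; rewrite addn1; exact: dirichlet_beta_sum_cvg.
rewrite -(cvg_lim _ h)//; apply: limr_le; first exact: cvgP h.
by apply: nearW => N; exact: sech_sum_expansion.
Qed.

(** The Taylor coefficients at 0 of [pi / (4 cosh (pi x / 2))]. *)
Definition sech_coef (R : realType) (n : nat) : R :=
  if odd n then 0 else (- 1) ^+ n./2 * dirichlet_beta R n.+1.

(** The odd coefficients vanish, so the first [n] terms contain
    [uphalf n] even ones. *)
Lemma sech_coef_partial (R : realType) (x : R) n :
  \sum_(k < n) sech_coef R k * x ^+ k =
  \sum_(i < uphalf n) (- 1) ^+ i * x ^+ (2 * i) * dirichlet_beta R (2 * i + 1).
Proof.
elim: n => [|n IH]; first by rewrite !big_ord0.
rewrite big_ord_recr /= IH uphalfE /= /sech_coef uphalf_half.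
case: ifP => on; first by rewrite mul0r addr0.
rewrite add0n big_ord_recr /=; congr (_ + _).
have e : (2 * n./2 = n)%N by rewrite -[RHS]odd_double_half on mul2n.
by rewrite e addn1; ring.
Qed.

Lemma sech_power_series (R : realType) (x : R) : `|x| < 1 ->
  (fun n => \sum_(k < n) sech_coef R k * x ^+ k) @ \oo -->
  pi / 4 / cosh_lin x (pi / 2).
Proof.
move=> x1; apply/cvgrPdist_le => e e0.
have hx : (fun n => `|x| ^+ n) @ \oo --> (0 : R) by apply: cvg_expr; rewrite normr_id.
move/cvgrPdist_le: hx => /(_ e e0) [N0 _ hN].
exists N0.+1 => //= -[//|n] /= nN; rewrite sech_coef_partial /=.
apply: le_trans (sech_asymptotic _ (ltW x1)) _.
have := hN n.+1 (ltnW nN); rewrite sub0r normrN normrX normr_id; apply: le_trans.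
apply: le_trans (ler_norm _) _; rewrite normrX.
apply: ler_wiXn2l => //; first exact: ltW.
by rewrite mul2n; have := odd_double_half n; case: odd => /=; lia.
Qed.

(** Only nonzero [x] are assumed, so that the lemma can be applied again after
    division by [x]; the constant term is then recovered by continuity at 0,
    from the geometric bound given by convergence at [x = 1/2]. *)
(** * Uniqueness of power series and Euler numbers *)

Lemma power_series_coef0 (R : realType) (c : nat -> R) :
  (forall x, 0 < `|x| < 1 -> (fun n => \sum_(k < n) c k * x ^+ k) @ \oo --> (0 : R)) ->
  c 0%N = 0.
Proof.
move=> h.
have [C C0 hC] : exists2 C : R, 0 < C & forall k, `|c k| <= C * 2 ^+ k.
  have h2 := h (1 / 2) _.
  have : cvgn (series (fun k => c k * (1 / 2) ^+ k)).
    rewrite (_ : series _ = fun n => \sum_(k < n) c k * (1 / 2) ^+ k).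
      by apply: cvgP; apply: h2; rewrite ger0_norm; lra.
    by apply/funext => n; rewrite /series /= big_mkord.
  move=> /cvg_series_bounded /ex_strict_bound_gt0 [C C0 hC].
  exists C => // k; have /= := hC k I; rewrite normrM => /ltW.
  rewrite (ger0_norm (_ : 0 <= (1 / 2) ^+ k)) ?exprn_ge0//.
  by rewrite expr_div_n expr1n mul1r ler_pdivrMr// exprn_gt0.
apply/eqP/negPn/negP => c0.
have nc0 : 0 < `|c 0%N| by rewrite normr_gt0.
(* With [2 x = y <= 1/2] the terms after the first add up to at most
   [2 C y], which the second bound on [y] makes at most half of [`|c 0|]. *)
pose y := Num.min (1 / 2) (`|c 0%N| / (4 * C)).
have y0 : 0 < y by rewrite lt_min divr_gt0//= divr_gt0// mulr_gt0.
have y2 : y <= 1 / 2 by rewrite ge_min lexx.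
have yc : 4 * C * y <= `|c 0%N|.
  by rewrite mulrC -ler_pdivlMr ?mulr_gt0// ge_min lexx orbT.
pose x := y / 2.
have xy : 2 * x = y by rewrite /x; field.
have x0 : 0 < x by rewrite divr_gt0.
clearbody x.
have bnd n : `|\sum_(k < n.+1) c k * x ^+ k - c 0%N| <= C * (2 * y).
  rewrite big_ord_recl /= expr0 mulr1 addrAC subrr add0r.
  apply: le_trans (ler_norm_sum _ _ _) _.
  apply: (@le_trans _ _ (\sum_(k < n) C * y ^+ k.+1)).
    apply: ler_sum => k _; rewrite normrM /bump /= add1n (ger0_norm (exprn_ge0 _ (ltW x0))).
    by rewrite -xy exprMn mulrA ler_wpM2r ?exprn_ge0 ?(ltW x0).
  rewrite -mulr_sumr ler_wpM2l ?(ltW C0)//.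
  have -> : \sum_(k < n) y ^+ k.+1 = y * \sum_(k < n) y ^+ k.
    by rewrite mulr_sumr; apply: eq_bigr => k _; rewrite exprS.
  rewrite mulrC ler_wpM2r ?(ltW y0)//.
  have := subrX1 y n; have := exprn_ge0 n (ltW y0); nra.
have hx : (fun n => `|\sum_(k < n.+1) c k * x ^+ k - c 0%N|) @ \oo --> `|0 - c 0%N|.
  apply: cvg_norm; apply: cvgB; last exact: cvg_cst.
  have := h x; rewrite gtr0_norm// => /(_ _); rewrite -cvg_shiftS; apply.
  by rewrite x0; lra.
have : `|0 - c 0%N| <= C * (2 * y).
  rewrite -(cvg_lim _ hx)//; apply: limr_le; first exact: cvgP hx.
  exact: nearW.
by rewrite sub0r normrN; lra.
Qed.

Lemma power_series_eq0 (R : realType) (c : nat -> R) :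
  (forall x, 0 < `|x| < 1 -> (fun n => \sum_(k < n) c k * x ^+ k) @ \oo --> (0 : R)) ->
  forall n, c n = 0.
Proof.
move=> h n; elim: n c h => [|n IH] c h; first exact: power_series_coef0.
apply: (IH (fun k => c k.+1)) => x /[dup] hx /andP[x0 _].
have xn0 : x != 0 by rewrite -normr_gt0.
have := h x hx; rewrite -cvg_shiftS /= => h1.
have : (fun n => x^-1 * \sum_(k < n.+1) c k * x ^+ k) @ \oo --> x^-1 * 0.
  by apply: cvgMr.
rewrite mulr0 (_ : (fun n => _) = fun n => \sum_(k < n) c k.+1 * x ^+ k)//.
apply/funext => p; rewrite big_ord_recl /= (power_series_coef0 h) mul0r add0r mulr_sumr.
by apply: eq_bigr => k _; rewrite /bump /= add1n exprS; field.
Qed.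

Lemma dirichlet_beta_dist1 (R : realType) s : `|1 - dirichlet_beta R s.+1| <= (3 ^+ s.+1)^-1.
Proof.
have := dirichlet_beta_sum_dist R s 1.
by rewrite /dirichlet_beta_sum big_ord1 /inv_odd muln0 add0n expr1n invr1 expr0 mulr1 muln1.
Qed.

Lemma dirichlet_beta_gt0 (R : realType) s : 0 < dirichlet_beta R s.+1.
Proof.
have : (3 ^+ s.+1)^-1 < 1 :> R.
  by rewrite invf_lt1 ?exprn_gt0// exprn_egt1//; lra.
by have := dirichlet_beta_dist1 R s; rewrite ler_norml => /andP[]; lra.
Qed.

(** Both [pi / 4 * E_n / n! * (pi/2)^n] and [sech_coef n] are the coefficients
    of [pi / (4 cosh (pi x / 2))] as a power series in [x]. *)
Lemma euler_number_beta (R : realType) (E : nat -> R) m : euler_numbers E ->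
  `|E (2 * m)%N| * pi ^+ (2 * m + 1) =
  4 ^+ (m + 1) * ((2 * m)`!)%:R * dirichlet_beta R (2 * m + 1).
Proof.
move=> hE; have pi0 := pi_gt0 R.
pose e n : R := pi / 4 * (E n / n`!%:R * (pi / 2) ^+ n).
have eE n : e n = sech_coef R n.
  apply/eqP; rewrite -subr_eq0; apply/eqP; move: n.
  apply: power_series_eq0 => x /andP[_ x1].
  have zx : `|pi / 2 * x| < pi / 2.
    rewrite normrM gtr0_norm; last by rewrite divr_gt0.
    by rewrite gtr_pMr// divr_gt0.
  have h1 : (fun n => \sum_(k < n) e k * x ^+ k) @ \oo --> pi / 4 / cosh_lin x (pi / 2).
    have -> : pi / 4 / cosh_lin x (pi / 2) =
       pi / 4 * (2 / (expR (pi / 2 * x) + expR (- (pi / 2 * x)))) :> R.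
      rewrite /cosh_lin mulNr ![x * _]mulrC; field.
      by rewrite gt_eqF// addr_gt0// expR_gt0.
    rewrite (_ : (fun n => _) = fun n => pi / 4 *
        series (fun n => E n * ((pi / 2 * x) ^+ n / n`!%:R)) n).
      by apply: cvgMr; exact: hE.
    apply/funext => n; rewrite /series /= big_mkord mulr_sumr.
    by apply: eq_bigr => k _; rewrite /e [(_ * x) ^+ k]exprMn; ring.
  rewrite [X in _ --> X](_ : _ = pi / 4 / cosh_lin x (pi / 2) -
      pi / 4 / cosh_lin x (pi / 2)); last by rewrite subrr.
  rewrite (_ : (fun n => _) = fun n => \sum_(k < n) e k * x ^+ k -
      \sum_(k < n) sech_coef R k * x ^+ k).
    by apply: cvgB; [exact: h1|exact: sech_power_series].
  apply/funext => n; rewrite -sumrB.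
  by apply: eq_bigr => k _; rewrite mulrBl.
have := eE (2 * m)%N.
rewrite /sech_coef /e mul2n odd_double doubleK -mul2n => /(congr1 Num.norm).
rewrite [in RHS]normrM [in RHS]normrX normrN1 expr1n mul1r.
rewrite (gtr0_norm (dirichlet_beta_gt0 _ _)) addn1 => <-.
have f0 : ((2 * m)`!)%:R != 0 :> R by rewrite pnatr_eq0 -lt0n fact_gt0.
have p0 : 0 < pi / 2 :> R by rewrite divr_gt0.
rewrite !normrM normrX (gtr0_norm p0) !normfV (gtr0_norm pi0) !normr_nat.
rewrite expr_div_n [2 ^+ (2 * m)]exprM.
have -> : (2 : R) ^+ 2 = 4 by ring.
have q0 : (4 : R) ^+ m != 0 by rewrite expf_neq0.
by rewrite !addn1 [4 ^+ _]exprS [pi ^+ _.+1]exprS; field; rewrite q0.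
Qed.

(** * Positivity of the inner sums *)

(** For [s >= 1], the moment of [x^2 (1 - 2 x^2)^q] for the measure
    [log(1/x)^(s-1) / (s-1)! dx] on [[0, 1]], under which [x^(2j+2)] has integral
    [(2j+3) ^- s]. *)
Definition log_moment (R : realFieldType) (s q : nat) : R :=
  \sum_(j < q.+1) (- 2) ^+ j * 'C(q, j)%:R / (2 * j + 3)%:R ^+ s.

Lemma log_moment0 (R : realFieldType) q : log_moment R 0 q = (- 1) ^+ q.
Proof.
rewrite (_ : -1 = 1 + (- 2) :> R); last by ring.
rewrite exprDn; apply: eq_bigr => j _.
by rewrite expr1n expr0 divr1 mul1r mulr_natr.
Qed.

Lemma log_moment_at0 (R : realFieldType) s : log_moment R s 0 = (3 ^+ s)^-1.
Proof. by rewrite /log_moment big_ord1 expr0 bin0 !mul1r. Qed.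

(** Multiplying the [j]-th term by [2j+3] lowers [s] by one, and
    [2 (q+1) + 3 - (2j+3) = 2 (q+1-j)] is absorbed by
    [(q+1-j) 'C(q+1, j) = (q+1) 'C(q, j)]. *)
Lemma log_moment_rec (R : realFieldType) s q :
  (2 * q%:R + 5) * log_moment R s.+1 q.+1 =
  log_moment R s q.+1 + 2 * (q%:R + 1) * log_moment R s.+1 q.
Proof.
have e : log_moment R s.+1 q = \sum_(j < q.+2)
    (- 2) ^+ j * 'C(q, j)%:R / (2 * j + 3)%:R ^+ s.+1.
  by rewrite big_ord_recr /= bin_small// mulr0 mul0r addr0.
rewrite e /log_moment !mulr_sumr -big_split /=; apply: eq_bigr => j _.
have jq : (j <= q.+1)%N by rewrite -ltnS.
have h : (q%:R + 1 - j%:R) * 'C(q.+1, j)%:R = (q%:R + 1) * 'C(q, j)%:R :> R.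
  by rewrite natr1 -natrB// -!natrM -mul_bin_down.
have d : 2 * j%:R + 3 != 0 :> R by rewrite -natrM -natrD pnatr_eq0 addn3.
have -> : 2 * (q%:R + 1) * ((- 2) ^+ j * 'C(q, j)%:R / (2 * j + 3)%:R ^+ s.+1) =
  2 * (- 2) ^+ j * ((q%:R + 1) * 'C(q, j)%:R) / (2 * j + 3)%:R ^+ s.+1 :> R.
  by ring.
by rewrite -h exprS natrD natrM; field; rewrite d expf_neq0.
Qed.

(** For [s = 1] the moments alternate in sign; this bound is stable under two
    steps of the recurrence and is just strong enough for [s = 2]. *)
Lemma log_moment1_even_ge (R : realFieldType) n :
  (4 * ((2 * n)%:R + 1))^-1 <= log_moment R 1 (2 * n).
Proof.
elim: n => [|n IH].
  by rewrite log_moment_at0 muln0 add0r mulr1 expr1 lef_pV2 ?posrE//; lra.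
have := log_moment_rec R 0 (2 * n); have := log_moment_rec R 0 (2 * n).+1.
rewrite !log_moment0 mulnS add2n !exprS exprM sqrrN !expr1n.
rewrite -[(2 * n).+2%:R]natr1 -[(2 * n).+1%:R]natr1.
move: IH; set x := (2 * n)%:R; set a := log_moment R 1 (2 * n).
set b := log_moment R 1 (2 * n).+1; set c := log_moment R 1 (2 * n).+2.
have x0 : 0 <= x by [].
clearbody x a b c => IH h1 h2.
have ha : 1 / 2 <= 2 * (x + 1) * a.
  apply: le_trans (ler_wpM2l _ IH); last lra.
  by rewrite le_eqVlt; apply/orP; left; apply/eqP; field; lra.
have hb : - (1 / 2) <= (2 * x + 5) * b by lra.
have hc : (x + 3) <= (2 * x + 5) * ((2 * x + 7) * c).
  have := ler_wpM2l (_ : 0 <= 2 * (x + 2)) hb; nra.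
rewrite -div1r ler_pdivrMr; last lra.
have hd : (x + 3) * (4 * (x + 3)) <= (2 * x + 5) * (2 * x + 7) * (c * (4 * (x + 3))).
  rewrite [leRHS](_ : _ = (2 * x + 5) * ((2 * x + 7) * c) * (4 * (x + 3))); last ring.
  by apply: ler_wpM2r => //; lra.
have hp : 0 < (2 * x + 5) * (2 * x + 7) by apply: mulr_gt0; lra.
rewrite [x + 1 + 1 + 1](_ : _ = x + 3); last ring.
rewrite -(ler_pM2l hp). apply: le_trans hd; nra.
Qed.

(** The moments of order 1 with even [q] are positive, so the recurrence
    preserves positivity when it reaches an even [q]; when it reaches an odd one,
    the negative moment of order 1 is compensated by the preceding even one. *)
Lemma log_moment2_gt0 (R : realFieldType) n :
  0 < log_moment R 2 (2 * n) /\ 0 < log_moment R 2 (2 * n).+1.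
Proof.
have odd_of_even k : 0 < log_moment R 2 (2 * k) ->
    (2 * (2 * k)%:R + 3) * log_moment R 2 (2 * k) >= log_moment R 1 (2 * k) ->
    0 < log_moment R 2 (2 * k).+1.
  have := log_moment_rec R 1 (2 * k); have := log_moment_rec R 0 (2 * k).
  rewrite !log_moment0 exprS exprM sqrrN !expr1n.
  have := log_moment1_even_ge R k.
  set x := (2 * k)%:R; set a := log_moment R 1 (2 * k).
  set b := log_moment R 1 (2 * k).+1; set c := log_moment R 2 (2 * k).
  set d := log_moment R 2 (2 * k).+1.
  have x0 : 0 <= x by [].
  clearbody x a b c d => ha h1 h2 c0 hc.
  have ha' : 1 <= a * (4 * (x + 1)) by rewrite -ler_pdivrMr ?div1r//; lra.
  have hp : 0 < 2 * x + 5 by lra.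
  have hq : 0 < 2 * x + 3 by lra.
  rewrite -(pmulr_rgt0 _ hp) h2 -(pmulr_rgt0 _ hp) -(pmulr_rgt0 _ hq).
  nra.
elim: n => [|n [_ IH]].
  have e : 0 < log_moment R 2 (2 * 0) by rewrite log_moment_at0 invr_gt0 exprn_gt0.
  by split=> //; apply: odd_of_even => //; rewrite muln0 !log_moment_at0; lra.
rewrite mulnS add2n.
have := log_moment_rec R 1 (2 * n).+1.
have := log_moment1_even_ge R n.+1; rewrite mulnS add2n.
set a := log_moment R 1 _; set c := log_moment R 2 _ => ha h.
have a0 : 0 < a by apply: lt_le_trans ha; rewrite invr_gt0 mulr_gt0// natr1.
have ac : a <= (2 * (2 * n).+2%:R + 3) * c.
  rewrite -[(2 * n).+2%:R]natr1 (_ : _ + 3 = 2 * (2 * n).+1%:R + 5); last ring.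
  by rewrite h lerDl !mulr_ge0// ltW.
have c0 : 0 < c.
  have k0 : 0 < 2 * (2 * n).+2%:R + 3 :> R by rewrite ltr_wpDl// mulr_ge0.
  by rewrite -(pmulr_rgt0 c k0) (lt_le_trans a0).
split=> //; have := odd_of_even n.+1; rewrite mulnS add2n; exact.
Qed.

(** All terms of [log_moment_rec] that determine [log_moment s.+1 q.+1] are positive
    once exponent [s] is settled. *)
Lemma log_moment_gt0 (R : realFieldType) s q : 0 < log_moment R s.+2 q.
Proof.
elim: s q => [q|s IH q].
  rewrite -[q](odd_double_half) -mul2n.
  by have [] := log_moment2_gt0 R q./2; case: odd.
elim: q => [|q IHq]; first by rewrite log_moment_at0 invr_gt0 exprn_gt0.
have p : 0 < 2 * q%:R + 5 :> R by rewrite ltr_wpDl// mulr_ge0.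
rewrite -(pmulr_rgt0 _ p) log_moment_rec addr_gt0// mulr_gt0// mulr_gt0//.
Qed.

Lemma inner_sumE (R : realType) m p :
  inner_sum R m p.+1 = 2 * log_moment R (2 * m + 1) p.
Proof.
rewrite /inner_sum big_add1 big_mkord mulr_sumr; apply: eq_bigr => j _.
rewrite !subn1 /= mulnS [(2 + _ + 1)%N](_ : _ = (2 * j + 3)%N); last by rewrite addnAC addnC.
rewrite !exprS [(- 2) ^+ j](_ : _ = (- 1) ^+ j * 2 ^+ j); last by rewrite -exprMn mulN1r.
by ring.
Qed.

Lemma inner_sum_ge0 (R : realType) m p : (1 <= m)%N -> 0 <= inner_sum R m p.
Proof.
case: p => [|p] m1; first by rewrite /inner_sum big_geq.
rewrite inner_sumE mulr_ge0// ltW//.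
by case: m m1 => // m _; rewrite mulnS -addnA addn1 add2n log_moment_gt0.
Qed.

(** * The Euler transformation *)

(** The right-hand side averages the partial sums of [c] with the binomial
    weights of [P] trials of success probability [2/3].  Pascal's rule gives the
    induction step: it splits the average for [P+1] according to the last
    trial. *)
Lemma euler_transform_partial (R : realFieldType) (c : nat -> R) P :
  \sum_(p < P) (3 ^+ p.+1)^-1 * (\sum_(k < p.+1) 2 ^+ k.+1 * c k * 'C(p, k)%:R)
  = (\sum_(j < P.+1) 'C(P, j)%:R * 2 ^+ j * \sum_(k < j) c k) / 3 ^+ P.
Proof.
elim: P => [|P IH]; first by rewrite big_ord0 big_ord1 big_ord0 mulr0 mul0r.
rewrite big_ord_recr /= IH.
set A := fun j : nat => \sum_(k < j) c k.
have -> : \sum_(j < P.+2) 'C(P.+1, j)%:R * 2 ^+ j * A j =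
   \sum_(j < P.+1) 'C(P, j)%:R * 2 ^+ j * A j +
   \sum_(j < P.+1) 'C(P, j)%:R * 2 ^+ j.+1 * A j.+1.
  rewrite big_ord_recl /= bin0 expr0.
  under eq_bigr do rewrite /bump /= add1n binS natrD !mulrDl.
  rewrite big_split /= big_ord_recr /= bin_small// !mul0r addr0.
  rewrite [in RHS]big_ord_recl /= bin0 expr0 addrA; congr (_ + _).
have -> : \sum_(j < P.+1) 'C(P, j)%:R * 2 ^+ j.+1 * A j.+1 =
    2 * (\sum_(j < P.+1) 'C(P, j)%:R * 2 ^+ j * A j) +
    \sum_(k < P.+1) 2 ^+ k.+1 * c k * 'C(P, k)%:R.
  rewrite mulr_sumr -big_split /=; apply: eq_bigr => j _.
  by rewrite /A big_ord_recr /= exprS; ring.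
have h : (3 : R) ^+ P != 0 by rewrite expf_neq0.
by rewrite exprS /A; field.
Qed.

(** The rate [1/(j+1)] is convenient since the mean of [1/(X+1)] for a
    binomial [X] has a closed form, by [mul_bin_diag], of order [1/P]. *)
Lemma euler_transform (R : realType) (c : nat -> R) (L : R) :
  (forall j, `|\sum_(k < j) c k - L| <= (j.+1%:R)^-1) ->
  (fun P => \sum_(p < P) (3 ^+ p.+1)^-1 *
     (\sum_(k < p.+1) 2 ^+ k.+1 * c k * 'C(p, k)%:R)) @ \oo --> L.
Proof.
move=> hL.
have bnd P : `|(\sum_(j < P.+1) 'C(P, j)%:R * 2 ^+ j * \sum_(k < j) c k) / 3 ^+ P - L|
    <= 3 / 2 * harmonic P.
  have p3 : 0 < 3 ^+ P :> R by rewrite exprn_gt0.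
  have e3 : 3 ^+ P = \sum_(j < P.+1) 'C(P, j)%:R * 2 ^+ j :> R.
    rewrite (_ : 3 = 1 + 2); last by ring.
    by rewrite exprDn; apply: eq_bigr => j _; rewrite expr1n mul1r mulr_natl.
  rewrite -(ler_pM2r p3) -[X in _ * X <= _](gtr0_norm p3) -normrM mulrBl.
  rewrite divfK ?gt_eqF// [in L * _]e3 mulr_sumr -sumrB.
  apply: le_trans (ler_norm_sum _ _ _) _.
  apply: (@le_trans _ _ (\sum_(j < P.+1) 'C(P, j)%:R * 2 ^+ j / j.+1%:R)).
    apply: ler_sum => j _; rewrite [L * _]mulrC -mulrBr normrM ger0_norm ?mulr_ge0//.
    by rewrite ler_wpM2l ?mulr_ge0.
  rewrite /harmonic /= [leRHS](_ : _ = 3 ^+ P.+1 / (2 * P.+1%:R)); last first.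
    by rewrite exprS; field; rewrite nat1r.
  rewrite ler_pdivlMr ?mulr_gt0//.
  rewrite (_ : 3 = 1 + 2); last by ring.
  rewrite exprDn [leRHS]big_ord_recl /= ler_wpDl// mulr_suml ler_sum// => j _.
  rewrite /bump /= add1n !expr1n mul1r -mulr_natl mulr1.
  have := mul_bin_diag P.+1 j => /(congr1 (fun n => n%:R : R)) /=.
  rewrite !natrM => h.
  have j0 : j.+1%:R != 0 :> R by rewrite pnatr_eq0.
  rewrite -[leRHS]mulr_natl -['C(P.+1, _)%:R](mulKf j0) -h exprS le_eqVlt; apply/orP; left.
  by apply/eqP; field; rewrite nat1r.
under eq_fun do rewrite euler_transform_partial.
apply/cvgrPdist_le => e e0.
have h0 : (fun P => 3 / 2 * harmonic P : R) @ \oo --> (3 / 2 * 0 : R).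
  by apply: cvgMr; exact: cvg_harmonic.
rewrite mulr0 in h0; move/cvgrPdist_le: h0 => /(_ e e0).
apply: filterS => P; rewrite sub0r normrN => hP.
by rewrite distrC (le_trans (bnd P))// (le_trans (ler_norm _)).
Qed.

(** Euler transformation of the alternating series
    [1 - beta = 1/3^s - 1/5^s + ...]. *)
Lemma series_inner_sum (R : realType) m :
  series (fun n => (1 / 3) ^+ n * inner_sum R m n) @ \oo --> 1 - dirichlet_beta R (2 * m + 1).
Proof.
rewrite -cvg_shiftS /=.
pose c k : R := (- 1) ^+ k * inv_odd R (2 * m + 1) k.+1.
rewrite (_ : (fun n => _) = fun P => \sum_(p < P) (3 ^+ p.+1)^-1 *
    \sum_(k < p.+1) 2 ^+ k.+1 * c k * 'C(p, k)%:R); last first.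
  apply/funext => P; rewrite /series /= big_mkord big_ord_recl /=.
  rewrite {1}/inner_sum big_geq// mulr0 add0r; apply: eq_bigr => p _.
  rewrite /bump /= add1n expr_div_n expr1n div1r; congr (_ * _).
  rewrite /inner_sum big_add1 big_mkord; apply: eq_bigr => k _.
  by rewrite !subn1 /= /c /inv_odd !exprS; ring.
apply: euler_transform => j.
have e : \sum_(k < j) c k = 1 - dirichlet_beta_sum R (2 * m + 1) j.+1.
  rewrite /dirichlet_beta_sum big_ord_recl /= /inv_odd muln0 add0n expr1n invr1 mul1r.
  rewrite opprD addNKr -sumrN; apply: eq_bigr => k _.
  by rewrite /bump /= add1n /c exprS /inv_odd; ring.
rewrite e addn1 (_ : 1 - _ - _ =
  - (dirichlet_beta_sum R (2 * m).+1 j.+1 - dirichlet_beta R (2 * m).+1)); last by ring.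
rewrite normrN (le_trans (dirichlet_beta_sum_dist _ _ _))//.
by rewrite (le_trans (inv_odd_le _ _ _))// /harmonic /= lef_pV2 ?posrE// ler_nat.
Qed.

(** * Compositions and inverse powers of a series *)

Definition convolution (R : nzRingType) (u v : nat -> R) (n : nat) : R :=
  \sum_(i < n.+1) u i * v (n - i)%N.

(** The coefficients of the [j]-th power of the formal series with
    coefficients [b]. *)
Fixpoint conv_pow (R : nzRingType) (b : nat -> R) (j : nat) : nat -> R :=
  if j is j'.+1 then convolution b (conv_pow b j') else fun n => (n == 0)%:R.

Lemma coef_poly_exp (R : comNzRingType) (b : nat -> R) N j n : (n <= N)%N ->
  ((\poly_(i < N.+1) b i) ^+ j)`_n = conv_pow b j n.
Proof.
elim: j n => [|j IH] n nN; first by rewrite expr0 coef1.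
rewrite exprS coefM /= /convolution; apply: eq_bigr => i _.
have iN : (i <= N)%N by rewrite (leq_trans _ nN)// -ltnS.
by rewrite coef_poly ltnS iN IH// (leq_trans (leq_subr _ _)).
Qed.

(** Compositions of [n] in [j] parts are the monomials of degree [n] in the
    expansion of the [j]-th power of the polynomial with coefficients [b]; tuples
    with a zero entry contribute nothing because [b 0 = 0]. *)
Lemma sum_compositions (R : comNzRingType) (b : nat -> R) n j : b 0%N = 0 ->
  \sum_(t : j.-tuple 'I_n.+1 | is_composition t) \prod_(l < j) b (tnth t l) =
  conv_pow b j n.
Proof.
move=> b0; rewrite -(coef_poly_exp b j (leqnn n)).
rewrite -[j in RHS]card_ord -prodr_const poly_def.
rewrite (bigA_distr_bigA (fun (_ : 'I_j) (i : 'I_n.+1) => b i *: 'X^i)).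
rewrite coef_sum (reindex (fun t : j.-tuple 'I_n.+1 => [ffun l => tnth t l])) /=; last first.
  exists (fun f : {ffun 'I_j -> 'I_n.+1} => [tuple f l | l < j]) => [t _|f _].
    by apply: eq_from_tnth => l; rewrite tnth_mktuple ffunE.
  by apply/ffunP => l; rewrite ffunE tnth_mktuple.
rewrite big_mkcond /=; apply: eq_bigr => t _.
rewrite scaler_prod -expr_sum coefZ coefXn.
under [X in _ = X * _]eq_bigr do rewrite ffunE.
under [X in _ = _ * (_ == X)%:R]eq_bigr do rewrite ffunE.
rewrite /is_composition [n == _]eq_sym; case: eqP => _; last by rewrite andbF mulr0.
rewrite andbT mulr1; case: forallP => // h.
have [l hl] : exists l, (tnth t l : nat) = 0%N.
  apply: contrapT => hN; apply: h => l; rewrite lt0n; apply/eqP => h0.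
  by apply: hN; exists l.
by rewrite (bigD1 l)//= hl b0 mul0r.
Qed.

Lemma conv_pow_small (R : nzRingType) (b : nat -> R) j n : b 0%N = 0 ->
  (n < j)%N -> conv_pow b j n = 0.
Proof.
move=> b0; elim: j n => // j IH n nj /=.
rewrite /convolution big1// => -[[|i] /= iN] _; first by rewrite b0 mul0r.
by rewrite IH ?mulr0//; lia.
Qed.

Lemma conv_pow_ge0 (R : numDomainType) (b : nat -> R) j n :
  (forall i, 0 <= b i) -> 0 <= conv_pow b j n.
Proof.
move=> b0; elim: j n => [|j IH] n /=; first exact: ler0n.
by apply: sumr_ge0 => i _; rewrite mulr_ge0.
Qed.

Lemma conv_pow1 (R : nzRingType) (b : nat -> R) n : conv_pow b 1 n = b n.
Proof.
rewrite /= /convolution big_ord_recr /= subnn eqxx mulr1 big1 ?add0r// => i _.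
by rewrite subn_eq0 leqNgt ltn_ord mulr0.
Qed.

Lemma conv_pow_scale (R : comNzRingType) (b : nat -> R) w j n :
  conv_pow (fun i => w ^+ i * b i) j n = w ^+ n * conv_pow b j n.
Proof.
elim: j n => [|j IH] n /=.
  by case: eqP => [->|_]; rewrite ?mulr0// expr0 mul1r.
rewrite /convolution mulr_sumr; apply: eq_bigr => i _.
have iN : (i <= n)%N by rewrite -ltnS.
have -> : w ^+ n = w ^+ i * w ^+ (n - i) by rewrite -exprD subnKC.
by rewrite IH; ring.
Qed.

(** The coefficient of [X^n] in [(1 - \sum_i b_i X^i) ^- r] when [b 0 = 0], by
    the negative binomial series.  For [r = j = 0] the truncated subtraction
    gives ['C(0, 0) = 1], as it should. *)
Definition inv_pow_coef (R : nzRingType) (b : nat -> R) (r n : nat) : R :=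
  \sum_(j < n.+1) 'C(r + j - 1, j)%:R * conv_pow b j n.

Lemma inv_pow_coef_widen (R : nzRingType) (b : nat -> R) r n N : b 0%N = 0 ->
  (n <= N)%N ->
  inv_pow_coef b r n = \sum_(j < N.+1) 'C(r + j - 1, j)%:R * conv_pow b j n.
Proof.
move=> b0 nN; rewrite /inv_pow_coef.
rewrite (big_ord_widen N.+1 (fun j => 'C(r + j - 1, j)%:R * conv_pow b j n))//.
rewrite [LHS]big_mkcond; apply: eq_bigr => j _; case: ltnP => // nj.
by rewrite conv_pow_small// mulr0.
Qed.

Lemma inv_pow_coef0 (R : nzRingType) (b : nat -> R) n :
  inv_pow_coef b 0 n = (n == 0)%:R.
Proof.
rewrite /inv_pow_coef big_ord_recl /= bin0 mul1r big1 ?addr0// => j _.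
by rewrite /bump /= add1n add0n subn1 bin_small ?mul0r.
Qed.

(** This is [(1 - b)^-(r+1) = (1 - b)^-r + b (1 - b)^-(r+1)]; on binomial
    coefficients it is Pascal's rule. *)
Lemma inv_pow_coefS (R : comNzRingType) (b : nat -> R) r n : b 0%N = 0 ->
  inv_pow_coef b r.+1 n = inv_pow_coef b r n + convolution b (inv_pow_coef b r.+1) n.
Proof.
move=> b0; rewrite !(@inv_pow_coef_widen _ _ _ n n.+1)//.
rewrite !(big_ord_recl n.+1) -addrA; congr (_ + _).
  by rewrite /= !bin0.
rewrite [X in _ = _ + X](_ : _ = \sum_(i < n.+1) 'C(r + i, i)%:R * conv_pow b i.+1 n).
  rewrite -big_split /=; apply: eq_bigr => i _; rewrite /bump /= add1n.
  have -> : (r.+1 + i.+1 - 1 = (r + i).+1)%N by lia.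
  have -> : (r + i.+1 - 1 = r + i)%N by lia.
  by rewrite binS natrD mulrDl. 
rewrite /= /convolution.
transitivity (\sum_(i < n.+1) b i *
    \sum_(j < n.+1) 'C(r + j, j)%:R * conv_pow b j (n - i)%N).
  apply: eq_bigr => i _; rewrite (@inv_pow_coef_widen _ _ _ _ n) ?leq_subr//.
  by under eq_bigr do rewrite addSn subn1.
under eq_bigr do rewrite mulr_sumr.
rewrite exchange_big /=; apply: eq_bigr => j _.
by rewrite mulr_sumr; apply: eq_bigr => i _; ring.
Qed.

Lemma inv_pow_coef_ge0 (R : numDomainType) (b : nat -> R) r n :
  (forall i, 0 <= b i) -> 0 <= inv_pow_coef b r n.
Proof.
by move=> b0; apply: sumr_ge0 => j _; rewrite mulr_ge0// conv_pow_ge0.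
Qed.

Lemma inv_pow_coef_scale (R : comNzRingType) (b : nat -> R) w r n :
  inv_pow_coef (fun i => w ^+ i * b i) r n = w ^+ n * inv_pow_coef b r n.
Proof.
rewrite /inv_pow_coef mulr_sumr; apply: eq_bigr => j _.
by rewrite conv_pow_scale; ring.
Qed.

Lemma series_convolution (R : realType) (b u : nat -> R) N :
  series (convolution b u) N = \sum_(i < N) b i * series u (N - i)%N.
Proof.
elim: N => [|N IH]; first by rewrite /series /= big_geq// big_ord0.
rewrite seriesSr IH big_ord_recr /= subSnn /convolution big_ord_recr /= subnn.
rewrite [series u 1](_ : _ = u 0%N); last by rewrite /series /= big_nat1.
rewrite addrA -big_split /=; congr (_ + _); apply: eq_bigr => i _.
by rewrite subSn 1?ltnW// seriesSr mulrDr.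
Qed.

(** With nonnegative terms, the partial sums of a convolution are squeezed
    between products of partial sums: the product up to [N] dominates the
    convolution up to [N] and is dominated by the convolution up to [2N].  The
    upper estimate bounds the partial sums of [u], and both together give
    [U = V + B U] for its sum [U]. *)
Lemma cvg_renewal (R : realType) (b u v : nat -> R) (B V : R) :
  (forall n, 0 <= b n) -> (forall n, 0 <= u n) -> (forall n, 0 <= v n) ->
  (forall n, u n = v n + convolution b u n) -> B < 1 ->
  series b @ \oo --> B -> series v @ \oo --> V ->
  series u @ \oo --> V / (1 - B).
Proof.
move=> b0 u0 v0 uE B1 hB hV.
have mono (f : nat -> R) : (forall n, 0 <= f n) -> nondecreasing_seq (series f).
  by move=> f0; apply: nondecreasing_series.
have le_l (f : nat -> R) l N : (forall n, 0 <= f n) -> series f @ \oo --> l -> series f N <= l.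
  move=> f0 hf; rewrite -(cvg_lim _ hf)//.
  by apply: nondecreasing_cvgn_le; [exact: mono|exact: cvgP hf].
have sge0 (f : nat -> R) N : (forall n, 0 <= f n) -> 0 <= series f N.
  by move=> f0; apply: sumr_ge0.
have sE N : series u N = series v N + series (convolution b u) N.
  by rewrite /series /= -big_split; apply: eq_bigr => n _; exact: uE.
have up N : series (convolution b u) N <= series b N * series u N.
  rewrite series_convolution [series b N]/series /= big_mkord mulr_suml; apply: ler_sum => i _.
  by rewrite ler_wpM2l// mono// leq_subr.
have lo N : series b N * series u N <= series (convolution b u) (N + N)%N.
  rewrite series_convolution big_split_ord /= [series b N]/series /= big_mkord mulr_suml.
  apply: (@le_trans _ _ (\sum_(i < N) b i * series u (N + N - i)%N)).
    apply: ler_sum => i _; rewrite ler_wpM2l// mono//.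
    by rewrite -addnBA ?leq_addr// ltnW.
  by rewrite lerDl sumr_ge0// => i _; rewrite mulr_ge0 ?sge0.
have ub N : series u N <= V / (1 - B).
  rewrite ler_pdivlMr ?subr_gt0// mulrBr mulr1 lerBlDr.
  rewrite {1}sE; apply: lerD; first exact: le_l.
  by apply: le_trans (up N) _; rewrite mulrC ler_wpM2l ?sge0 ?le_l.
have cu : cvgn (series u).
  by apply: nondecreasing_is_cvgn; [exact: mono|exists (V / (1 - B)) => _ [N _ <-]].
have e : lim (series u @ \oo) = V / (1 - B).
  apply/eqP; rewrite eq_le; apply/andP; split.
    by apply: limr_le => //; apply: nearW.
  rewrite ler_pdivrMr ?subr_gt0// mulrBr mulr1 lerBrDr.
  have h1 : (fun N => series v N + series b N * series u N) @ \oo -->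
      V + B * lim (series u @ \oo).
    by apply: cvgD => //; apply: cvgM.
  rewrite [X in _ + X]mulrC -(cvg_lim _ h1)//.
  apply: limr_le; first exact: cvgP h1.
  apply: nearW => N; apply: le_trans (le_l u _ (N + N)%N u0 cu).
  by rewrite (sE (N + N)%N) lerD// mono// leq_addr.
by rewrite -e.
Qed.

Lemma cvg_inv_pow (R : realType) (b : nat -> R) (B : R) r :
  b 0%N = 0 -> (forall n, 0 <= b n) -> B < 1 -> series b @ \oo --> B ->
  series (inv_pow_coef b r) @ \oo --> ((1 - B) ^+ r)^-1.
Proof.
move=> b0 bge B1 hB; elim: r => [|r IH].
  rewrite expr0 invr1; apply: cvg_near_cst.
  exists 1%N => //= N /= N1; rewrite /series /= big_ltn//= inv_pow_coef0 eqxx.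
  rewrite big_nat_cond big1 ?addr0// => n /andP[/andP[n0 _] _].
  by rewrite inv_pow_coef0 gtn_eqF.
rewrite exprSr invfM.
apply: (@cvg_renewal _ b _ (inv_pow_coef b r) B) => // n; rewrite ?inv_pow_coef_ge0//.
exact: inv_pow_coefS.
Qed.

Lemma coefficientE (R : realType) m r n : (1 <= n)%N ->
  coefficient R m r n = inv_pow_coef (inner_sum R m) r n.
Proof.
move=> n1; rewrite /coefficient /inv_pow_coef big_ord_recl /=.
rewrite [n == 0]eqn0Ngt n1 mulr0 add0r big_add1 big_mkord.
by apply: eq_bigr => j _; rewrite sum_compositions// /inner_sum big_geq.
Qed.

(** * Rationality and positivity of the coefficients *)

Definition is_rational (R : realType) (x : R) : Prop := exists q : rat, x = ratr q.

Lemma is_rationalD (R : realType) (x y : R) :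
  is_rational x -> is_rational y -> is_rational (x + y).
Proof. by move=> [p ->] [q ->]; exists (p + q); rewrite rmorphD. Qed.

Lemma is_rationalM (R : realType) (x y : R) :
  is_rational x -> is_rational y -> is_rational (x * y).
Proof. by move=> [p ->] [q ->]; exists (p * q); rewrite rmorphM. Qed.

Lemma is_rational_nat (R : realType) n : is_rational (n%:R : R).
Proof. by exists n%:R; rewrite rmorph_nat. Qed.

Lemma is_rationalX (R : realType) (x : R) n : is_rational x -> is_rational (x ^+ n).
Proof. by move=> [p ->]; exists (p ^+ n); rewrite rmorphXn. Qed.

Lemma is_rationalV (R : realType) (x : R) : is_rational x -> is_rational x^-1.
Proof. by move=> [p ->]; exists p^-1; rewrite fmorphV. Qed.

Lemma inner_sum_rational (R : realType) m p : is_rational (inner_sum R m p).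
Proof.
apply: big_ind => [||k _]; [exact: (is_rational_nat R 0)|exact: is_rationalD|].
have sgn : is_rational (- 1 : R) by exists (- 1); rewrite rmorphN1.
by do !apply: is_rationalM; try apply: is_rationalV;
  try apply: is_rationalX; try exact: is_rational_nat.
Qed.

Lemma coefficient_rational (R : realType) m r n : is_rational (coefficient R m r n).
Proof.
apply: big_ind => [||j _]; [exact: (is_rational_nat R 0)|exact: is_rationalD|].
apply: is_rationalM; first exact: is_rational_nat.
apply: big_ind => [||t _]; [exact: (is_rational_nat R 0)|exact: is_rationalD|].
apply: big_ind => [||l _]; [exact: (is_rational_nat R 1)|exact: is_rationalM|].
exact: inner_sum_rational.
Qed.

Lemma coefficient_gt0 (R : realType) m r n : (1 <= m)%N -> (1 <= r)%N ->
  (1 <= n)%N -> 0 < coefficient R m r n.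
Proof.
move=> m1 r1; case: n => // n _; rewrite coefficientE// /inv_pow_coef.
have b0 i : 0 <= inner_sum R m i by exact: inner_sum_ge0.
(* The compositions with one part contribute [r b_n > 0]. *)
rewrite (bigD1 (inord 1)) //= inordK// ltr_pwDl//.
  rewrite addnK bin1 conv_pow1 mulr_gt0 ?ltr0n//.
  rewrite inner_sumE mulr_gt0//; case: m m1 {b0} => // m _.
  by rewrite mulnS addn1 add2n log_moment_gt0.
by apply: sumr_ge0 => j _; rewrite mulr_ge0// conv_pow_ge0.
Qed.

(** * Conclusion *)

Theorem theorem6p1 (R : realType) (E : nat -> R) (hE : euler_numbers E)
    (m r : nat) (hm : (1 <= m)%N) (hr : (1 <= r)%N) :
  ((fun N : nat =>
      1 + \sum_(1 <= n < N.+1) 1 / 3 ^+ n * coefficient R m r n : R) @ \oo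
     --> (4 ^+ (m + 1) * ((2 * m)`!)%:R) ^+ r
         / (`|E (2 * m)%N| ^+ r * pi ^+ ((2 * m + 1) * r)))
  /\ (forall n : nat, (1 <= n)%N ->
        exists q : rat, 0 < q /\ coefficient R m r n = ratr q).
Proof.
split; last first.
  move=> n n1; have [q hq] := coefficient_rational R m r n; exists q; split=> //.
  by rewrite -(ltr0q R) -hq coefficient_gt0.
have eB := euler_number_beta m hE.
have b0 : 0 < dirichlet_beta R (2 * m + 1) by rewrite addn1 dirichlet_beta_gt0.
have -> : (4 ^+ (m + 1) * ((2 * m)`!)%:R) ^+ r
         / (`|E (2 * m)%N| ^+ r * pi ^+ ((2 * m + 1) * r)) =
    ((1 - (1 - dirichlet_beta R (2 * m + 1))) ^+ r)^-1.
  by rewrite exprM -exprMn eB subKr -expr_div_n -exprVn invfM mulrA divff ?mul1r//.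
pose b n : R := (1 / 3) ^+ n * inner_sum R m n.
have h : series (inv_pow_coef b r) @ \oo -->
    ((1 - (1 - dirichlet_beta R (2 * m + 1))) ^+ r)^-1.
  apply: cvg_inv_pow; last exact: series_inner_sum.
  - by rewrite /b /inner_sum big_geq ?mulr0.
  - by move=> n; rewrite mulr_ge0 ?exprn_ge0// inner_sum_ge0.
  - lra.
move: h; rewrite -cvg_shiftS /= => h.
rewrite (_ : (fun N => _) = fun N => series (inv_pow_coef b r) N.+1)//.
apply/funext => N; rewrite /series /= [RHS]big_ltn//; congr (_ + _).
  by rewrite /inv_pow_coef big_ord1 /= bin0 mulr1.
rewrite [LHS]big_nat [RHS]big_nat; apply: eq_bigr => n /andP[n1 _].
by rewrite inv_pow_coef_scale coefficientE// expr_div_n expr1n.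
Qed.
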